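(* Let $G=(V,E,s,t)$ be a directed multigraph with finite arc set $E$ and two distinguished vertices $s,t\in V$ (possibly equal). Let $V'$ be the set of nonsinks of $G$. Assume that $E\neq\varnothing$. Then the path-free complex $\mathcal{PF}(G)$ has one of the following two homotopy types: (a) If $G$ contains a useless arc or a cycle, then $\mathcal{PF}(G)$ is contractible. (b) Otherwise, $\mathcal{PF}(G)$ is homotopy-equivalent to a sphere of dimension $\#V'-2$.
   Context: Graphs are directed multigraphs; each arc has a source and a target in $V$; parallel arcs and self-loops are allowed. A walk from $v_0$ to $v_n$ is a sequence $(v_0,e_1,v_1,\ldots,e_n,v_n)$ with $n\ge 0$, $v_i\in V$, $e_i\in E$, where each $e_i$ is an arc from $v_{i-1}$ to $v_i$. A path is a walk that does not visit any vertex more than once; an $s-t$-path is a path from $s$ to $t$ (if $s=t$, this is the trivial path with no arcs). A cycle is a walk with $n\ge1$, $v_0=v_n$ and $v_0,\ldots,v_{n-1}$ distinct (so a self-loop gives a cycle). A nonsink is a vertex that is the source of at least one arc. A useless arc is an arc that belongs to no $s-t$-path. A set $F\subseteq E$ contains a path if it contains every arc of it. A simplicial complex on a finite ground set $W$ is a set $\Delta$ of subsets of $W$ (its faces) closed under taking subsets; $\Delta=\varnothing$ is allowed, as is $\Delta=\{\varnothing\}$, and singletons need not be faces. The path-free complex is $\mathcal{PF}(G)=\{F\subseteq E : F \text{ contains no } s-t\text{-path}\}$, with ground set $E$. Homotopy notions for a complex refer to its geometric realization. Conventions: the empty complex $\Delta=\varnothing$ (with no faces at all) is considered contractible; a complex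 $\Delta$ is said to be ''homotopy-equivalent to a sphere of dimension $-1$'' if $\Delta=\{\varnothing\}$. *)

(* Defs.v *)
From HB Require Import structures.
From mathcomp Require Import all_boot all_order all_algebra finmap.
From mathcomp Require Import all_classical all_reals all_analysis.

Set Implicit Arguments.
Unset Strict Implicit.
Unset Printing Implicit Defensive.

Import Order.TTheory GRing.Theory Num.Theory.
Import numFieldNormedType.Exports.

Local Open Scope classical_set_scope.
Local Open Scope ring_scope.

Section Homotopy.
Variable R : realType.

Definition homotopic (X Y : topologicalType) (f g : X -> Y) : Prop :=
  exists H : R * X -> Y,
    [/\ {within [set z : R * X | 0 <= z.1 <= 1], continuous H},
        forall x, H (0, x) = f x & forall x, H (1, x) = g x].

Definition homotopy_equivalent (X Y : topologicalType) : Prop :=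
  exists (f : X -> Y) (g : Y -> X),
    [/\ continuous f, continuous g,
        homotopic (g \o f) idfun & homotopic (f \o g) idfun].

Definition contractible_space (X : topologicalType) : Prop :=
  homotopy_equivalent X (set_type [set (0 : R)]).

(* The Euclidean unit sphere of dimension n; the library norm on row vectors
   is the sup norm, hence the explicit sum of squares. *)
Definition sphere (n : nat) : set 'rV[R]_n.+1 :=
  [set x : 'rV[R]_n.+1 | \sum_i (x ord0 i) ^+ 2 = 1].

End Homotopy.

Arguments sphere : clear implicits.

Section Complexes.
Variable W : finType.

(* No face at all is allowed, and singletons need not be faces. *)
Record simplicial_complex := SimplicialComplex {
  faces :> set {set W};
  faces_closed : forall A B : {set W}, A \subset B -> faces B -> faces A }.

Variable R : realType.

(* Convex combinations (in barycentric coordinates) whose support is a face,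
   inside R^W with the product topology. *)
Definition realization (D : simplicial_complex) : set {ptws W -> R} :=
  [set x : {ptws W -> R} | [/\ forall w, 0 <= x w, \sum_w x w = 1
                            & faces D [set w | x w != 0]%SET]].

Definition contractible (D : simplicial_complex) : Prop :=
  faces D = set0 \/ contractible_space R (set_type (realization D)).

(* Posz n is the dimension n >= 0, and Negz 0 is the dimension -1. *)
Definition homotopy_sphere (D : simplicial_complex) (d : int) : Prop :=
  match d with
  | Posz n =>
      homotopy_equivalent R (set_type (realization D)) (set_type (sphere R n))
  | Negz 0 => faces D = [set finset.set0]
  | Negz _ => False
  end.

End Complexes.

Arguments realization {W} R D _.

Record digraph := Digraph {
  vert : choiceType;
  darc : finType;
  src : darc -> vert;
  tgt : darc -> vert;
  s_ : vert;
  t_ : vert }.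

Section Digraph.
Variable G : digraph.

(* The walk (v_0, e_1, v_1, ..., e_n, v_n) is encoded by v_0 and the sequence
   of its arcs: v_i is the target of e_i for i >= 1. *)
Fixpoint walk (v : vert G) (p : seq (darc G)) (w : vert G) : Prop :=
  match p with
  | [::] => v = w
  | e :: p' => src e = v /\ walk (tgt e) p' w
  end.

Definition walk_vertices (v : vert G) (p : seq (darc G)) : seq (vert G) :=
  v :: [seq tgt e | e <- p].

Definition is_path (v : vert G) (p : seq (darc G)) (w : vert G) : Prop :=
  walk v p w /\ uniq (walk_vertices v p).

Definition st_path (p : seq (darc G)) : Prop := is_path (s_ G) p (t_ G).

(* [belast] drops v_n from v_0, ..., v_n. *)
Definition is_cycle (v : vert G) (p : seq (darc G)) : Prop :=
  [/\ p <> [::], walk v p v & uniq (belast v [seq tgt e | e <- p])].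

Definition has_cycle : Prop := exists v p, is_cycle v p.

Definition useless (e : darc G) : Prop := ~ exists2 p, st_path p & e \in p.

Definition nonsinks : {fset vert G} := [fset src e | e : darc G]%fset.

Definition contains_path (F : {set darc G}) (p : seq (darc G)) : Prop :=
  {subset p <= F}.

Definition path_free_faces : set {set darc G} :=
  [set F | ~ exists2 p, st_path p & contains_path F p].

Lemma path_free_closed (A B : {set darc G}) :
  A \subset B -> path_free_faces B -> path_free_faces A.
Proof.
move=> /fintype.subsetP sAB nB [p pst pA]; apply: nB; exists p => // e /pA.
exact: sAB.
Qed.

Definition path_free : simplicial_complex (darc G) :=
  SimplicialComplex path_free_closed.

End Digraph.

(* Main.v *)
Require Import Defs.
From mathcomp Require Import all_boot all_order all_algebra finmap boolp.

(* A face F determines the set of sources of its arcs. If G is acyclic and has no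
   useless arc, this gives a simplicial map from PF(G) to the boundary of the
   simplex on the nonsinks: if every nonsink had an arc of F leaving it, following
   these arcs from s would end at t. For a proper nonempty set S of nonsinks, the
   faces with sources in S form a cone, whose apex a(S) is an arc from S to a
   nonsink outside S (or any arc from S, if s is not in S). Sending the barycenter
   of S to a(S) defines a homotopy inverse on the barycentric subdivision: for a
   chain of sets S containing the sources of F, adding the apexes a(S) to F in
   increasing order keeps F a face.

   If G has a useless arc, PF(G) is a cone. If G has a cycle, merge a set X of
   vertices into the source and argue by deletion and link of an arc leaving X:
   both have the same form with fewer arcs and still contain the cycle, hence they
   collapse, and so does the complex. *)

Set Implicit Arguments.
Unset Strict Implicit.
Unset Printing Implicit Defensive.

(** * Collapses of path-free complexes *)

(* Faces are removed in pairs including the empty face, so that a single point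
   collapses to the complex without faces; this makes [collapses_link] uniform. *)
Inductive collapses (W : finType) : {set {set W}} -> Prop :=
| collapses0 : collapses set0
| collapsesS (K : {set {set W}}) (S : {set W}) (v : W) of v \notin S & S \in K & v |: S \in K
    & (forall F, F \in K -> S \subset F -> F = S \/ F = v |: S)
    & collapses (K :\: [set S; v |: S]) : collapses K.

(** A face of largest size contains [v], since adding [v] cannot enlarge it. Removing it together
    with its face without [v] leaves a family still closed under adding and removing [v]. *)
Lemma collapses_cone (W : finType) (K : {set {set W}}) (v : W) :
  (forall F, F \in K -> v |: F \in K) -> (forall F, F \in K -> F :\ v \in K) ->
  collapses K.
Proof.
have [n] := ubnP #|K|; elim: n K => // n IHn K ltKn addv remv.
have [->|[F0 KF0]] := set_0Vmem K; first exact: collapses0.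
pose F := [arg max_(F > F0 in K) #|F|].
have [KF maxF] : F \in K /\ forall F', F' \in K -> #|F'| <= #|F|.
  by rewrite /F; case: arg_maxnP.
have vF : v \in F.
  apply/negPn/negP => vF; have := maxF _ (addv _ KF).
  by rewrite cardsU1 vF ltnn.
have eqF : v |: F :\ v = F by rewrite setD1K.
have KFv := remv _ KF.
apply: (@collapsesS _ K (F :\ v) v) => //; rewrite ?setD11 ?eqF //.
  move=> F' KF' sFF'; have [vF'|vF'] := boolP (v \in F').
    right; apply/esym/eqP; rewrite eqEcard maxF // andbT -eqF.
    by rewrite subUset sub1set vF'.
  left; apply/esym/eqP; rewrite eqEcard sFF' /=.
  have := maxF _ (addv _ KF'); rewrite cardsU1 vF'.
  by rewrite [#|F|](cardsD1 v) vF !add1n ltnS.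
apply: IHn.
- apply: leq_trans (_ : #|K| <= n); last by rewrite -ltnS.
  apply: proper_card; apply/properP; split; first exact: subsetDl.
  by exists F => //; rewrite !inE eqxx orbT.
- move=> F'; rewrite !inE !negb_or => /andP[/andP[nF' nF] KF'].
  rewrite addv // andbT; apply/andP; split; apply/eqP => eF'.
    by have := setD11 v F; rewrite -eF' setU11.
  have [vF'|vF'] := boolP (v \in F').
    by case/eqP: nF; rewrite -eF'; apply/esym/setUidPr; rewrite sub1set.
  by case/eqP: nF'; rewrite -eF' setU1K.
- move=> F'; rewrite !inE !negb_or => /andP[/andP[nF' nF] KF'].
  rewrite remv // andbT; apply/andP; split; apply/eqP => eF'.
    have [vF'|vF'] := boolP (v \in F').
      by case/eqP: nF; rewrite -(setD1K vF') eF' eqF.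
    case/eqP: nF'; rewrite -eF'; apply/setP => x; rewrite !inE.
    by case: eqP => // ->; apply: negbTE.
  by have := setD11 v F'; rewrite eF' vF.
Qed.

(** [L] is the link of [v]. Each pair removed from the link, joined with [v], can be removed from
    [K]; once the link is used up, only the deletion of [v] remains. *)
Lemma collapses_link (W : finType) (v : W) (L K : {set {set W}}) :
  collapses L -> (forall F, F \in L = (v \notin F) && (v |: F \in K)) ->
  collapses [set F in K | v \notin F] -> collapses K.
Proof.
move=> cL; elim: cL K => {L} [|L S w wS LS LwS maxS _ IHL] K eL cD.
  suff -> : K = [set F in K | v \notin F] by [].
  apply/setP => F; rewrite !inE; case: (boolP (F \in K)) => //= KF.
  apply/esym/negP => vF; have := eL (F :\ v).
  by rewrite inE setD11 setD1K ?KF.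
have := LS; rewrite eL => /andP[vS KS].
have := LwS; rewrite eL => /andP[vwS KwS].
have wv : w != v by apply: contra vwS => /eqP->; rewrite setU11.
have eC : v |: (w |: S) = w |: (v |: S) by rewrite setUCA.
apply: (@collapsesS _ K (v |: S) w) => //; rewrite -?eC //.
- by rewrite !inE negb_or wv.
- move=> F KF sF; have vF : v \in F by apply: (fintype.subsetP sF); rewrite setU11.
  have [] := maxS (F :\ v).
  + by rewrite eL setD11 setD1K.
  + apply/fintype.subsetP => x xS; rewrite !inE (fintype.subsetP sF) ?inE ?xS ?orbT //.
    by rewrite andbT; apply: contraNneq vS => <-.
  + by move=> eF; left; rewrite -eF setD1K.
  + by move=> eF; right; rewrite -eF setD1K.
apply: IHL.
- move=> F; rewrite !inE !negb_or eL; have [vF|vF] /= := boolP (v \in F).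
    by rewrite andbF.
  suff inj : forall S' : {set W}, v \notin S' -> (v |: F == v |: S') = (F == S').
    by rewrite !inj.
  move=> S' vS'; apply/eqP/eqP => [e|->] //.
  by rewrite -(setU1K vF) e setU1K.
- suff -> : [set F in K :\: [set v |: S; v |: (w |: S)] | v \notin F]
            = [set F in K | v \notin F] by [].
  apply/setP => F; rewrite !inE; case: (boolP (v \in F)) => vF; rewrite ?andbF //.
  rewrite !andbT; case: eqP => [eF|_]; first by rewrite eF setU11 in vF.
  by case: eqP => [eF|_] //; rewrite eF setU11 in vF.
Qed.

(** * Walks, paths and closed walks *)

Lemma walk_split (G : digraph) (u v w : vert G) p :
  walk u p w -> v \in walk_vertices u p ->
  exists q r, [/\ p = q ++ r, walk u q v & walk v r w].
Proof.
elim: p u => [|e p IHp] u /=.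
  by move=> <-; rewrite inE => /eqP ->; exists [::], [::].
case=> <- pw; rewrite inE => /orP[/eqP ->|]; first by exists [::], (e :: p).
by case/(IHp _ pw) => q [r [-> qv rw]]; exists (e :: q), r.
Qed.

Lemma walk_cat (G : digraph) (u w : vert G) p q :
  walk u (p ++ q) w <-> exists2 v, walk u p v & walk v q w.
Proof.
elim: p u => [|e p IHp] u /=; first by split=> [qw|[v ->]]; first exists u.
rewrite IHp; split=> [[eu [v pv qw]]|[v [eu pv] qw]]; first by exists v.
by split=> //; exists v.
Qed.

Lemma walk_last (G : digraph) (v w : vert G) p :
  walk v p w -> last v [seq tgt e | e <- p] = w.
Proof. by elim: p v => [|e p IHp] v //= [_ /IHp]. Qed.

Lemma walk_vertices_uniq_cat (G : digraph) (u v : vert G) p q :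
  walk u p v -> uniq (walk_vertices u (p ++ q)) ->
  uniq (walk_vertices u p) /\ uniq (walk_vertices v q).
Proof.
rewrite /walk_vertices => /walk_last pv; rewrite map_cat -cat_cons lastI pv.
rewrite cat_rcons cat_uniq -cats1 => /and3P[up /= nvp ->]; split => //.
rewrite cat_uniq up /= andbT orbF.
by apply: contra nvp => ->.
Qed.

(** Arcs are prepended to a path one at a time; if the source of the new arc is already visited, the
    path is cut so as to start at that visit. *)
Lemma walk_path (G : digraph) (v w : vert G) p :
  walk v p w -> exists2 q, is_path v q w & {subset q <= p}.
Proof.
elim: p v => [|e p IHp] v /= => [->|]; first by exists [::].
case=> <- /IHp[q [qw uq] sqp].
have [vq|vq] := boolP (src e \in walk_vertices (tgt e) q).
  have [q1 [q2 [eq q1v q2w]]] := walk_split qw vq.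
  exists q2; first by split=> //; move: uq; rewrite eq => /(walk_vertices_uniq_cat q1v)[].
  by move=> x xq2; rewrite inE sqp ?orbT // eq mem_cat xq2 orbT.
exists (e :: q); first by split=> //=; rewrite -/(walk_vertices _ _) vq.
by move=> x; rewrite !inE => /orP[->//|/sqp ->]; rewrite orbT.
Qed.

(** The witness is what follows the last use of [e]. *)
Lemma walk_after (G : digraph) (v w : vert G) p e :
  walk v p w -> e \in p ->
  exists q, [/\ walk (tgt e) q w, {subset q <= p} & e \notin q].
Proof.
elim: p v => [|a p IHp] v //= [_ pw]; rewrite inE.
have [/(IHp _ pw)[q [qw sq eq]] _|ep] := boolP (e \in p).
  by exists q; split=> // x /sq xp; rewrite inE xp orbT.
rewrite orbF => /eqP ea; exists p; rewrite ea in ep *; split=> // x xp.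
by rewrite inE xp orbT.
Qed.

Lemma walk_pred (G : digraph) (v w : vert G) p e :
  walk v p w -> e \in p -> src e = v \/ exists2 a, a \in p & tgt a = src e.
Proof.
elim: p v => [|a p IHp] v //= [av pw]; rewrite inE.
case/orP => [/eqP ->|ep]; first by left.
right; have [->|[b bp <-]] := IHp _ pw ep; first by exists a; rewrite ?mem_head.
by exists b; rewrite // inE bp orbT.
Qed.

Lemma walk_succ (G : digraph) (v w : vert G) p e :
  walk v p w -> e \in p -> tgt e = w \/ exists2 a, a \in p & src a = tgt e.
Proof.
move=> pw ep; case/splitPr: ep pw => q r /walk_cat[u _ [_ rw]].
case: r rw => [|a r] /=; first by left.
by case=> ae _; right; exists a; rewrite // mem_cat !inE eqxx !orbT.
Qed.

Lemma closed_walk_pred (G : digraph) (v : vert G) p e :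
  walk v p v -> e \in p -> exists2 a, a \in p & tgt a = src e.
Proof.
move=> pv ep; have [->|//] := walk_pred pv ep.
case: p pv ep => // a p pv _; exists (last a p); first exact: mem_last.
by rewrite -(walk_last pv) /= last_map.
Qed.

(** * Path-free complexes with a set of sources *)

Definition reaches_sink (G : digraph) (X : vert G -> Prop) (F : {set darc G}) :=
  exists v p, [/\ X v, walk v p (t_ G) & {subset p <= F}].

(** Merging vertices into the source is expressed by the set [X] of starting vertices, deleting arcs
    by [A]. The empty walk counts, so there is no face once [t_ G] lies in [X]. *)
Definition unreached (G : digraph) (X : vert G -> Prop) (A : {set darc G}) :
  {set {set darc G}} := [set F : {set darc G} | (F \subset A) && ~~ `[< reaches_sink X F >]].

Lemma unreachedP (G : digraph) (X : vert G -> Prop) (A F : {set darc G}) :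
  reflect (F \subset A /\ ~ reaches_sink X F) (F \in unreached X A).
Proof.
rewrite inE; apply: (iffP andP) => -[-> /asboolPn ?] //.
Qed.

Lemma unreached_closed (G : digraph) (X : vert G -> Prop) (A F F' : {set darc G}) :
  F \subset F' -> F' \in unreached X A -> F \in unreached X A.
Proof.
move=> sF /unreachedP[sA nr]; apply/unreachedP; split.
  exact: fintype.subset_trans sF sA.
case=> v [p [Xv pt pF]]; apply: nr; exists v, p; split=> // x /pF.
exact: fintype.subsetP sF x.
Qed.

(* A closed walk makes the complex collapsible: if no arc is a cone apex then no
   arc ends in X and some arc e leaves X. The link of e arises by adding the
   target of e to X, its deletion by deleting e, and both keep the closed walk. *)
Lemma collapses_unreached (G : digraph) (X : vert G -> Prop) (A : {set darc G})
    (v : vert G) (c : seq (darc G)) :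
  c <> [::] -> walk v c v -> {subset c <= A} -> collapses (unreached X A).
Proof.
move=> c0 cv.
have [n] := ubnP #|A|; elim: n A X => // n IHn A X ltAn cA.
have [[e eA apex]|noapex] := pselect (exists2 e, e \in A &
    forall F, F \in unreached X A -> e |: F \in unreached X A).
  apply: (collapses_cone apex) => F; apply: unreached_closed.
  exact: subsetDl.
(* An arc [e] ending in [X] would be an apex: a walk using it can be restarted at its target, after
   the last use of [e]. *)
have notin : forall e, e \in A -> ~ X (tgt e).
  move=> e eA Xe; apply: noapex; exists e => // F /unreachedP[FA nr].
  apply/unreachedP; split; first by rewrite subUset sub1set eA.
  case=> u [p [Xu pt pF]]; apply: nr.
  have [ep|ep] := boolP (e \in p).
    have [q [qt qp eq]] := walk_after pt ep.
    exists (tgt e), q; split=> // x xq; have := pF _ (qp _ xq).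
    by rewrite !inE => /orP[/eqP xe|//]; rewrite -xe xq in eq.
  exists u, p; split=> // x xp; have := pF _ xp; rewrite !inE => /orP[/eqP xe|//].
  by rewrite -xe xp in ep.
have [a ac] : exists a, a \in c.
  by case: (c) c0 => // b c1 _; exists b; rewrite mem_head.
(* If no arc of [A] left [X], only empty walks could start in [X], so every arc would be an apex, in
   particular [a]. *)
have [e eA Xe] : exists2 e, e \in A & X (src e).
  apply: contrapT => nX; apply: noapex; exists a; first exact: cA.
  move=> F /unreachedP[FA nr]; apply/unreachedP.
  have aFA : a |: F \subset A by rewrite subUset sub1set cA.
  split=> //; case=> u [[|b p] [Xu pt pF]].
    by apply: nr; exists u, [::]; split=> // x.
  case: pt => bu _; apply: nX; exists b; last by rewrite bu.
  by apply: (fintype.subsetP aFA); apply: pF; rewrite mem_head.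
(* Otherwise the arc before [e] on the closed walk would end in [X]. *)
have ec : e \notin c.
  apply/negP => /(closed_walk_pred cv)[b bc be].
  by apply: (notin b); [exact: cA | rewrite be].
have ltAe : #|A :\ e| < n by rewrite [#|A|](cardsD1 e) eA add1n ltnS in ltAn.
have cAe : {subset c <= A :\ e}.
  by move=> x xc; rewrite !inE cA // andbT; apply: contraNneq ec => <-.
pose X' u := X u \/ u = tgt e.
(* Having [e] available amounts to being allowed to start at its target. *)
have reachX' F : reaches_sink X' F <-> reaches_sink X (e |: F).
  split=> [[u [p [[Xu|->] pt pF]]]|[u [p [Xu pt pF]]]].
  - by exists u, p; split=> // x /pF xF; rewrite !inE xF orbT.
  - exists (src e), (e :: p); split=> // x; rewrite !inE.
    by case/orP=> [->//|/pF ->]; rewrite orbT.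
  - have [ep|ep] := boolP (e \in p).
      have [q [qt qp eq]] := walk_after pt ep.
      exists (tgt e), q; split=> //; first by right.
      move=> x xq; have := pF _ (qp _ xq).
      by rewrite !inE => /orP[/eqP xe|//]; rewrite -xe xq in eq.
    exists u, p; split=> //; first by left.
    move=> x xp; have := pF _ xp.
    by rewrite !inE => /orP[/eqP xe|//]; rewrite -xe xp in ep.
apply: (collapses_link (v := e) (IHn _ X' ltAe cAe)).
  move=> F; apply/unreachedP/andP => [[sF nr]|[eF /unreachedP[sF nr]]].
    have [eF FA] := (subsetD1P sF).
    split=> //; apply/unreachedP; split; last by rewrite -reachX'.
    by rewrite subUset sub1set eA.
  split; last by rewrite reachX'.
  by apply/subsetD1P; split=> //; apply: fintype.subset_trans sF; exact: subsetUr.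
suff -> : [set F in unreached X A | e \notin F] = unreached X (A :\ e).
  exact: IHn.
apply/setP => F; rewrite !inE subsetD1; case: (e \in F); rewrite ?andbF ?andbT //.
Qed.

Lemma path_freeP (G : digraph) (F : {set darc G}) :
  path_free_faces F <-> ~ reaches_sink (eq (s_ G)) F.
Proof.
split=> [nF [_ [p [<- /walk_path[q qst qp] pF]]]|nF [p [pw _] pF]]; apply: nF.
  by exists q => // x /qp /pF.
by exists (s_ G), p.
Qed.

Lemma path_free_useless (G : digraph) (e : darc G) (F : {set darc G}) :
  useless e -> path_free_faces F -> path_free_faces (e |: F).
Proof.
move=> ue nF [p pst pF]; apply: nF; exists p => // x xp.
have := pF _ xp; rewrite !inE => /orP[/eqP xe|//].
by case: ue; exists p; rewrite // -xe.
Qed.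

Lemma collapses_path_free (G : digraph) :
  (exists e : darc G, useless e) \/ has_cycle G ->
  collapses [set F : {set darc G} | `[< path_free_faces F >]].
Proof.
case=> [[e ue]|[v [c [c0 cv _]]]].
  apply: (collapses_cone (v := e)) => F; rewrite !inE => /asboolP nF; apply/asboolP.
    exact: path_free_useless.
  by apply: path_free_closed nF; exact: subsetDl.
suff -> : [set F : {set darc G} | `[< path_free_faces F >]]
    = unreached (eq (s_ G)) [set: darc G].
  by apply: (collapses_unreached _ c0 cv) => x; rewrite inE.
apply/setP => F; rewrite inE; apply/asboolP/unreachedP.
  by rewrite finset.subsetT => /path_freeP.
by case=> _ /path_freeP.
Qed.

(** * Acyclic graphs without useless arcs *)

Lemma acyclic_walk_uniq (G : digraph) (v w : vert G) p :
  ~ has_cycle G -> walk v p w -> uniq (walk_vertices v p).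
Proof.
move=> ncyc; elim: p v => [|e p IHp] v //= [ev pw].
have up := IHp _ pw.
move: (up) => /= ->; rewrite andbT; apply/negP => vp; apply: ncyc.
(* If the first vertex recurs, the stretch back to it is a cycle, because the rest of the walk
   repeats no vertex by induction. *)
have [q [r [epq qv _]]] := walk_split pw vp.
exists v, (e :: q); split=> //=.
have := up; rewrite epq => /(walk_vertices_uniq_cat qv)[uq _].
move: uq; rewrite /walk_vertices lastI (walk_last qv) rcons_uniq.
by case/andP => -> ->.
Qed.

Lemma useful_arc_tgt (G : digraph) (e : darc G) :
  ~ useless e -> tgt e = t_ G \/ exists f, src f = tgt e.
Proof.
move=> /contrapT[p [pw _] ep].
by have [|[f _ ft]] := walk_succ pw ep; [left|right; exists f].
Qed.

Lemma useful_arc_endpoints (G : digraph) (e : darc G) :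
  ~ useless e -> s_ G <> t_ G /\ exists f, src f = s_ G.
Proof.
move=> /contrapT[[|f p] // [[fs pw] up] _]; split; last by exists f.
move=> st; move: up; rewrite st /= -(walk_last pw).
by rewrite mem_last.
Qed.

(** A path through [e] ends at [t_ G], so leaving [t_ G] along [e] would visit it twice. *)
Lemma useful_arc_src (G : digraph) (e : darc G) : ~ useless e -> src e <> t_ G.
Proof.
move=> /contrapT[p [pw up] ep] et.
case/splitPr: ep pw up => q r /walk_cat[u qu er].
move/(walk_vertices_uniq_cat qu); case: er => <- rt [_] /=.
by rewrite et -(walk_last rt) mem_last.
Qed.

(** If arcs of [F] left every nonsink, a walk in [F] from [s_ G] could be prolonged forever: a
    useful arc ends at a nonsink or at [t_ G], and the latter cannot be reached inside a face. *)
Lemma path_free_missing (G : digraph) (F : {set darc G}) :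
  (forall e : darc G, ~ useless e) -> ~ has_cycle G -> 0 < #|darc G| ->
  path_free_faces F -> exists e, forall f, f \in F -> src f <> src e.
Proof.
move=> useful acyc /card_gt0P[e0 _] nF; apply: contrapT => full.
have out e : exists2 f, f \in F & src f = src e.
  apply: contrapT => nf; apply: full; exists e => f fF fe; apply: nf.
  by exists f.
have [st [f0 f0s]] := useful_arc_endpoints (useful e0).
have long n : exists p v, [/\ walk (s_ G) p v, size p = n, {subset p <= F}
    & exists f, src f = v].
  elim: n => [|n [p [v [pv sp pF [f fv]]]]].
    by exists [::], (s_ G); split=> //; exists f0.
  have [g gF gf] := out f.
  exists (rcons p g), (tgt g); split; last 2 first.
  - by move=> x; rewrite mem_rcons inE => /orP[/eqP ->|/pF].
  - have [gt|//] := useful_arc_tgt (useful g).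
    case/path_freeP: nF; exists (s_ G), (rcons p g); split=> //; last first.
      by move=> x; rewrite mem_rcons inE => /orP[/eqP ->|/pF].
    by rewrite -cats1; apply/walk_cat; exists v; rewrite //= gf fv.
  - by rewrite -cats1; apply/walk_cat; exists v; rewrite //= gf fv.
  - by rewrite size_rcons sp.
(* A walk with more steps than there are arcs repeats an arc, although its vertices are distinct by
   acyclicity. *)
have [p [v [pv sp _ _]]] := long #|darc G|.+1.
have := acyclic_walk_uniq acyc pv; rewrite /= => /andP[_ /map_uniq up].
by have := max_card (mem p); rewrite (card_uniqP up) sp ltnn.
Qed.

(** The walk must leave [S] before using [e]; the arc [b] following the exit [a] shows that [a] ends
    at a nonsink. *)
Lemma walk_leaves (G : digraph) (S : vert G -> bool) (v w : vert G) p e :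
  walk v p w -> e \in p -> S v -> ~~ S (src e) ->
  exists a b, [/\ S (src a), ~~ S (tgt a) & src b = tgt a].
Proof.
elim: p v => [|a p IHp] v //= [av pw]; rewrite inE => /orP[/eqP ->|ep] Sv nSe.
  by rewrite av Sv in nSe.
have [Sa|nSa] := boolP (S (tgt a)); first exact: (IHp _ pw ep Sa nSe).
case: p pw ep {IHp} => // b p [ba _] _.
by exists a, b; rewrite av Sv.
Qed.

Lemma path_free_apex (G : digraph) (S : vert G -> bool) (e1 e2 : darc G) :
  (forall e : darc G, ~ useless e) -> S (src e1) -> ~~ S (src e2) ->
  exists2 a, S (src a) & forall F, path_free_faces F ->
    (forall f, f \in F -> S (src f)) -> path_free_faces (a |: F).
Proof.
move=> useful Se1 nSe2; have [st _] := useful_arc_endpoints (useful e1).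
have [Ss|nSs] := boolP (S (s_ G)); last first.
  (* With the source outside [S], no walk from it can begin with an arc whose own source is in
     [S]. *)
  exists e1 => // F _ FS [[|f p] [pw _] pF]; first by case: st.
  case: pw => fs _; have := pF f (mem_head _ _); rewrite !inE.
  case/orP => [/eqP fe1|/FS]; last by rewrite fs; exact/negP.
  by rewrite -fe1 fs (negbTE nSs) in Se1.
have [p [pw _] e2p] := contrapT (useful e2).
have [a [b [Sa nSa ba]]] := walk_leaves pw e2p Ss nSe2.
(* A path through [a] would have to go on from the target of [a], a nonsink and hence not [t_ G];
   but this target is outside [S], so no arc of [a |: F] leaves it. *)
exists a => // F nF FS [q [qw uq] qF].
apply: nF; exists q => // x xq; have := qF _ xq; rewrite !inE.
case/orP => [/eqP xa|//]; rewrite {x}xa in xq *.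
have [ta|[c cq ca]] := walk_succ qw xq.
  by case: (useful_arc_src (useful b)); rewrite ba.
have := qF _ cq; rewrite -ca in nSa.
by rewrite !inE => /orP[/eqP ac|/FS Sc]; [rewrite ac Sa in nSa|rewrite Sc in nSa].
Qed.

(** * Contractions from collapses *)

From mathcomp Require Import all_classical all_reals all_analysis.

Import Order.TTheory GRing.Theory Num.Theory.
Import numFieldNormedType.Exports.

Local Open Scope ring_scope.

(** * Continuity of maps given by coordinate formulas *)

Lemma continuous_addr (R : realType) (T : topologicalType) (f g : T -> R) :
  continuous f -> continuous g -> continuous (fun x => f x + g x).
Proof. by move=> cf cg x; apply: (@cvgD _ R _ _ _ f g); [exact: cf|exact: cg]. Qed.

Lemma continuous_oppr (R : realType) (T : topologicalType) (f : T -> R) :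
  continuous f -> continuous (fun x => - f x).
Proof. by move=> cf x; apply: (@cvgN _ R _ _ _ f); exact: cf. Qed.

Lemma continuous_mulr (R : realType) (T : topologicalType) (f g : T -> R) :
  continuous f -> continuous g -> continuous (fun x => f x * g x).
Proof. by move=> cf cg x; apply: (@cvgM R _ _ _ f g); [exact: cf|exact: cg]. Qed.

Lemma continuous_invr (R : realType) (T : topologicalType) (f : T -> R) :
  (forall x, f x != 0) -> continuous f -> continuous (fun x => (f x)^-1).
Proof. by move=> f0 cf x; apply: (@cvgV R _ _ _ f); [exact: f0|exact: cf]. Qed.

Lemma continuous_minr (R : realType) (T : topologicalType) (f g : T -> R) :
  continuous f -> continuous g -> continuous (fun x => Num.min (f x) (g x)).
Proof. by move=> cf cg x; apply: (@continuous_min R T f g); [exact: cf|exact: cg]. Qed.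

Lemma continuous_maxr (R : realType) (T : topologicalType) (f g : T -> R) :
  continuous f -> continuous g -> continuous (fun x => Num.max (f x) (g x)).
Proof. by move=> cf cg x; apply: (@continuous_max R T f g); [exact: cf|exact: cg]. Qed.

Lemma continuous_sumr (R : realType) (T : topologicalType) (I : Type) (s : seq I)
    (P : pred I) (F : I -> T -> R) :
  (forall i, P i -> continuous (F i)) ->
  continuous (fun x => \sum_(i <- s | P i) F i x).
Proof. by apply: continuous_big; exact: add_continuous. Qed.

Lemma continuous_prodr (R : realType) (T : topologicalType) (I : Type) (s : seq I)
    (P : pred I) (F : I -> T -> R) :
  (forall i, P i -> continuous (F i)) ->
  continuous (fun x => \prod_(i <- s | P i) F i x).
Proof. by apply: continuous_big; exact: mul_continuous. Qed.

Lemma continuous_cstr (R : realType) (T : topologicalType) (a : R) :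
  continuous (fun _ : T => a).
Proof. by move=> x; exact: cvg_cst. Qed.

Lemma continuous_ptws (R : realType) (T : topologicalType) (W : eqType)
    (f : T -> {ptws W -> R}) :
  (forall w, continuous (fun x => f x w)) -> continuous f.
Proof.
move=> cf x; apply/cvg_sup => w U [V [[B oB <-] Bfx]] /filterS; apply.
by apply: cf; apply: open_nbhs_nbhs.
Qed.

Lemma continuous_coord (R : realType) (W : eqType) (w : W) :
  continuous (fun x : {ptws W -> R} => x w).
Proof. exact: (@proj_continuous W (fun _ => R) w). Qed.

Lemma continuous_row (R : realType) (T : topologicalType) (n : nat)
    (f : T -> 'rV[R]_n) :
  (forall i, continuous (fun x => f x ord0 i)) -> continuous f.
Proof.
move=> cf x U [P Pfx sPU].
have Pf : \forall y \near x, forall i, P ord0 i (f y ord0 i).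
  by apply: filter_forall => i; apply: cf; exact: Pfx.
apply: filterS Pf => y Py; apply: sPU => i j.
by rewrite [i]ord1.
Qed.

Lemma continuous_comp2 (T U V : topologicalType) (f : T -> U) (g : U -> V) :
  continuous f -> continuous g -> continuous (fun x => g (f x)).
Proof. by move=> cf cg x; apply: continuous_comp; [exact: cf|exact: cg]. Qed.

Lemma continuous_fst (T U : topologicalType) : continuous (fun z : T * U => z.1).
Proof. by move=> z; exact: cvg_fst. Qed.

Lemma continuous_snd (T U : topologicalType) : continuous (fun z : T * U => z.2).
Proof. by move=> z; exact: cvg_snd. Qed.

Lemma continuous_pair (T U V : topologicalType) (f : T -> U) (g : T -> V) :
  continuous f -> continuous g -> continuous (fun x => (f x, g x)).
Proof. by move=> cf cg x; apply: cvg_pair; [exact: cf|exact: cg]. Qed.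

Lemma continuous_set_val (T : topologicalType) (A : set T) :
  continuous (fun x : set_type A => \val x).
Proof. exact: initial_continuous. Qed.

Lemma continuous_set_type (T U : topologicalType) (A : set U) (f : T -> set_type A) :
  continuous (fun x => \val (f x)) -> continuous f.
Proof. exact: continuous_comp_initial. Qed.

(** * Homotopies between maps into subsets *)

Definition to_set (T : Type) (A : set T) (x : T) (Ax : A x) : set_type A :=
  exist _ x (mem_set Ax).

(** A homotopy must be defined at all real times; clamping the time to the unit interval keeps its
    values in the target set. *)
Definition clamp (R : realType) (t : R) : R := Num.max 0 (Num.min t 1).

Lemma clamp_itv (R : realType) (t : R) : 0 <= clamp t <= 1.
Proof. by rewrite /clamp le_max lexx ge_max ler01 ge_min lexx orbT. Qed.

Lemma clamp_le0 (R : realType) (t : R) : t <= 0 -> clamp t = 0.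
Proof. by move=> t0; apply/max_idPl; rewrite ge_min t0. Qed.

Lemma clamp_ge1 (R : realType) (t : R) : 1 <= t -> clamp t = 1.
Proof. by move=> t1; rewrite /clamp (min_idPr t1); apply/max_idPr. Qed.

Lemma continuous_clamp (R : realType) (T : topologicalType) (f : T -> R) :
  continuous f -> continuous (fun x => clamp (f x)).
Proof.
move=> cf; apply: continuous_maxr; first exact: continuous_cstr.
by apply: continuous_minr => //; exact: continuous_cstr.
Qed.

Lemma homotopic_clamp (R : realType) (X V : topologicalType) (A : set V)
    (f g : X -> set_type A) (H : R -> X -> V) :
  continuous (fun z : R * X => H (clamp z.1) z.2) ->
  (forall t x, 0 <= t <= 1 -> A (H t x)) ->
  (forall x, H 0 x = \val (f x)) -> (forall x, H 1 x = \val (g x)) ->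
  homotopic R f g.
Proof.
move=> cH AH H0 H1.
exists (fun z => to_set (AH (clamp z.1) z.2 (clamp_itv z.1))); split.
- by apply: continuous_subspaceT; exact: continuous_set_type.
- by move=> x; apply: val_inj; rewrite /= clamp_le0 ?H0.
- by move=> x; apply: val_inj; rewrite /= clamp_ge1 ?H1.
Qed.

(* The ambient space is all of R^W, so that homotopies can be
   concatenated by adding coordinates. *)
Definition contraction (R : realType) (W : finType) (A : set {ptws W -> R})
    (H : R -> {ptws W -> R} -> {ptws W -> R}) : Prop :=
  [/\ continuous (fun z : R * {ptws W -> R} => H z.1 z.2),
      forall t x, 0 <= t <= 1 -> A x -> A (H t x),
      forall x, A x -> H 0 x = x
    & exists2 p, A p & forall x, A x -> H 1 x = p].

Lemma contraction_contractible (R : realType) (W : finType)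
    (A : set {ptws W -> R}) (H : R -> {ptws W -> R} -> {ptws W -> R}) :
  contraction A H -> contractible_space R (set_type A).
Proof.
case=> cH AH H0 [p Ap H1].
have Z0 : [set 0 : R]%classic 0 by [].
exists (fun=> to_set Z0), (fun=> to_set Ap); split.
- exact: cst_continuous.
- exact: cst_continuous.
(* Time is reversed: the required homotopy starts at the constant map and ends at the identity. *)
- pose K t (x : set_type A) := H (1 - t) (\val x).
  apply: (@homotopic_clamp R _ _ A _ _ K).
  + apply: (continuous_comp2 (g := fun z : R * {ptws W -> R} => H z.1 z.2)
      (f := fun z : R * set_type A => (1 - clamp z.1, \val z.2)) _ cH).
    apply: continuous_pair; last first.
      apply: (continuous_comp2 (g := fun x : set_type A => \val x)).
        exact: continuous_snd.
      exact: continuous_set_val.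
    apply: continuous_addr; first exact: continuous_cstr.
    apply: continuous_oppr; apply: continuous_clamp; exact: continuous_fst.
  + move=> t x t01; apply: AH; last exact: set_valP.
    by rewrite subr_ge0 lerBlDr lerDl andbC.
  + by move=> x; rewrite /K subr0 H1 //; exact: set_valP.
  + by move=> x; rewrite /K subrr H0 //; exact: set_valP.
- pose K (t : R) (x : set_type [set 0 : R]%classic) : R := 0.
  apply: (@homotopic_clamp R _ _ _ _ _ K) => //.
  + exact: continuous_cstr.
  + by move=> x; have := set_valP x.
Qed.

Definition realize (R : realType) (W : finType) (K : {set {set W}}) :
  set {ptws W -> R} :=
  (fun x : {ptws W -> R} =>
     [/\ forall w, 0 <= x w, \sum_w x w = 1 & [set w | x w != 0]%SET \in K]).

Lemma realize_le1 (R : realType) (W : finType) (K : {set {set W}})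
    (x : {ptws W -> R}) w : realize K x -> x w <= 1.
Proof.
by case=> x0 <- _; rewrite (bigD1 w) //= lerDl; apply: sumr_ge0.
Qed.

(* Composing the push along one elementary collapse with a contraction of the
   smaller complex; the push subtracts the minimum over S from the coordinates
   in S and adds the total to v. *)
Lemma collapses_contraction (R : realType) (W : finType) (K : {set {set W}}) :
  (forall F F' : {set W}, F \subset F' -> F' \in K -> F \in K) ->
  collapses K -> K <> finset.set0 ->
  exists H, contraction (realize (R := R) K) H.
Proof.
move=> + cK; elim: cK => {K} [//|K S v vS KS KvS maxS _ IHK] downK _.
pose K' := (K :\: [set S; v |: S])%SET.
have downK' (F F' : {set W}) : F \subset F' -> F' \in K' -> F \in K'.
  rewrite /K' !inE !negb_or => sF /andP[/andP[nS nvS] KF'].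
  rewrite (downK F F') // andbT; apply/andP; split; apply/eqP => eF.
    by rewrite eF in sF; have [e|e] := maxS _ KF' sF; [case/eqP: nS|case/eqP: nvS].
  rewrite eF in sF.
  have [e|e] := maxS _ KF' (fintype.subset_trans (finset.subsetUr _ _) sF).
    by case/eqP: nS.
  by case/eqP: nvS.
have K'K x : realize (R := R) K' x -> realize K x.
  by case=> x0 x1; rewrite inE => /andP[_ ?].
(* For empty [S] the only faces are the empty one and the singleton of [v], so the realization is
   one point. *)
have [S0|[u uS]] := set_0Vmem S.
  have eqp (x : {ptws W -> R}) : realize K x -> x = (fun w => (w == v)%:R).
    case=> x0 x1 /(maxS _); rewrite S0 finset.sub0set => /(_ isT) xS.
    have xv w : w != v -> x w = 0.
      move=> wv; apply/eqP; apply: contraT => xw.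
      have : w \in [set w | x w != 0]%SET by rewrite inE.
      by case: xS => ->; rewrite !inE // orbF (negbTE wv).
    apply/funext => w; have [->|/xv -> //] := eqVneq w v.
    by rewrite -x1 (bigD1 v) //= big1 ?addr0.
  exists (fun _ x => x); split=> //; first exact: continuous_snd.
  exists (fun w => (w == v)%:R); last by move=> x /eqp.
  split=> [w||]; first exact: ler0n.
  - by rewrite (bigD1 v) //= eqxx big1 ?addr0 // => w /negbTE ->.
  - suff -> : [set w | ((w == v)%:R : R) != 0]%SET = v |: S by [].
    apply/setP => w; rewrite S0 !inE orbF.
    by rewrite pnatr_eq0 eqb0 negbK.
(* As [S] is nonempty, the empty face stays in [K'] and the induction hypothesis applies. *)
have [|H [cH AH H0 [p Kp H1]]] := IHK downK'.
  rewrite -/K' => e; have : finset.set0 \in K'.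
    rewrite !inE negb_or (downK finset.set0 S) ?finset.sub0set // andbT.
    apply/andP; split; apply/eqP/setP.
      by move/(_ u); rewrite uS inE.
    by move/(_ v); rewrite !inE eqxx.
  by rewrite e inE.
(* The direction of the push; its entries add up to 0. The default 1 of the minimum [m] is harmless,
   as coordinates are at most 1 and [S] is nonempty. The factor 1 in [r] makes it the push at time
   1. *)
pose d w : R := if w == v then #|S|%:R else - (w \in S)%:R.
pose m (x : {ptws W -> R}) := \big[Num.min/1]_(w in S) x w.
pose r (x : {ptws W -> R}) : {ptws W -> R} := fun w => x w + 1 * (m x * d w).
have sumd : \sum_w d w = 0.
  rewrite (bigD1 v) //= /d eqxx; apply/eqP; rewrite addr_eq0; apply/eqP.
  rewrite (eq_bigr (fun w => - (w \in S)%:R)) => [|w /negbTE -> //].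
  rewrite sumrN opprK -sumr_const big_mkcond [RHS]big_mkcond /=.
  apply: eq_bigr => w _; have [->|_] := eqVneq w v; first by rewrite (negbTE vS).
  by case: (w \in S).
have m_le x w : w \in S -> m x <= x w by move=> wS; exact: bigmin_le_cond.
have m_attained x : realize K x -> exists2 w, w \in S & m x = x w.
  move=> Kx; have : m x = 1 \/ exists2 w, w \in S & m x = x w.
    rewrite /m; elim/big_ind: _ => [|y z IHy IHz|w wS]; [by left| |by right; exists w].
    by rewrite minEle; case: ifP.
  case=> // m1; exists u => //; apply/eqP; rewrite eq_le m_le //= m1.
  exact: realize_le1 Kx.
(* If the minimum is nonzero, the support contains [S], so it is [S] or [v |: S]. *)
have supp x w : realize K x -> m x != 0 -> x w != 0 -> w \in v |: S.
  move=> Kx mx xw; have [x0 _ xK] := Kx.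
  have sS : S \subset [set w | x w != 0]%SET.
    apply/fintype.subsetP => w' w'S; rewrite inE gt_eqF //.
    apply: lt_le_trans (m_le x w' w'S); rewrite lt_def mx.
    by have [w'' _ ->] := m_attained x Kx; rewrite x0.
  have : w \in [set w | x w != 0]%SET by rewrite inE.
  by have [->|->] := maxS _ xK sS => //; rewrite !inE => ->; rewrite orbT.
have push t x : 0 <= t <= 1 -> realize K x ->
    realize K (fun w => x w + t * (m x * d w)).
  move=> /andP[t0 t1] Kx; have [x0 x1 xK] := Kx.
  have m0 : 0 <= m x by have [w _ ->] := m_attained x Kx.
  split.
  - move=> w; rewrite /d; case: eqP => _; first by rewrite addr_ge0 ?mulr_ge0.
    have [wS|] := boolP (w \in S); last by rewrite oppr0 !mulr0 addr0.
    rewrite mulrN1 mulrN subr_ge0 (le_trans _ (m_le x w wS)) //.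
    by rewrite ler_piMl.
  - by rewrite big_split /= -mulr_sumr -mulr_sumr sumd !mulr0 addr0.
  - have [em|nm] := eqVneq (m x) 0.
      suff -> : [set w | x w + t * (m x * d w) != 0]%SET = [set w | x w != 0]%SET by [].
      by apply/setP => w; rewrite !inE em mul0r mulr0 addr0.
    apply: (downK _ (v |: S)) => //; apply/fintype.subsetP => w.
    move=> nw; have [xw|/(supp x w Kx nm)//] := eqVneq (x w) 0.
    have {nw} : x w + t * (m x * d w) != 0 by move: nw; rewrite inE.
    rewrite xw add0r /d !inE; have [//|_ /=] := eqVneq w v.
    by case: (w \in S) => //; rewrite oppr0 !mulr0 eqxx.
(* At time 1 the smallest coordinate in [S] has become 0, so the support no longer contains [S]. *)
have rK' x : realize K x -> realize K' (r x).
  move=> Kx; have [||r0 r1 rK] := push 1 x; rewrite ?ler01 ?lexx //.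
  split=> //; rewrite /K' !inE negb_or rK andbT.
  have [w wS mw] := m_attained x Kx.
  have rw : r x w = 0.
    rewrite /r /d wS; case: eqP => [wv|_]; first by rewrite -wv wS in vS.
    by rewrite mw mul1r mulrN1 subrr.
  apply/andP; split; apply/eqP/setP => /(_ w); rewrite inE rw eqxx ?inE wS //.
  by rewrite orbT.
(* The push takes the first half of the time, [H] the second. In the first half the last difference
   vanishes, since [H] starts at the identity; in the second the finished push cancels against
   [r x]. *)
pose L t (x : {ptws W -> R}) : {ptws W -> R} := fun w =>
  x w + clamp (2 * t) * (m x * d w) + (H (clamp (2 * t - 1)) (r x) w - r x w).
have L1 t x : t <= 2^-1 -> realize K x ->
    L t x = (fun w => x w + clamp (2 * t) * (m x * d w)).
  move=> t2 Kx; apply/funext => w; rewrite /L.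
  rewrite [clamp (2 * t - 1)]clamp_le0 ?H0 ?subrr ?addr0 //; first exact: rK'.
  by rewrite subr_le0 mulrC -ler_pdivlMr // mul1r.
have L2 t x : 2^-1 <= t -> L t x = H (clamp (2 * t - 1)) (r x).
  move=> t2; apply/funext => w; rewrite /L [clamp (2 * t)]clamp_ge1.
    by rewrite addrC subrK.
  by rewrite mulrC -ler_pdivrMr // mul1r.
exists L; split.
- have cx w : continuous (fun z : R * {ptws W -> R} => z.2 w).
    apply: (continuous_comp2 (g := fun x : {ptws W -> R} => x w)).
      exact: continuous_snd.
    exact: continuous_coord.
  have ct (a b : R) : continuous (fun z : R * {ptws W -> R} => clamp (a * z.1 + b)).
    apply: continuous_clamp; apply: continuous_addr; last exact: continuous_cstr.
    apply: continuous_mulr; [exact: continuous_cstr|exact: continuous_fst].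
  have cm : continuous (fun z : R * {ptws W -> R} => m z.2).
    apply: continuous_big => [|w _]; last exact: cx.
    by apply: continuous_minr; [exact: continuous_fst|exact: continuous_snd].
  have cmd w : continuous (fun z : R * {ptws W -> R} => m z.2 * d w).
    by apply: continuous_mulr => //; exact: continuous_cstr.
  have cr : continuous (fun z : R * {ptws W -> R} => r z.2).
    apply: continuous_ptws => w; apply: continuous_addr => //.
    by apply: continuous_mulr => //; exact: continuous_cstr.
  apply: continuous_ptws => w; apply: continuous_addr.
    apply: continuous_addr => //; apply: continuous_mulr => //.
    have -> : (fun z : R * {ptws W -> R} => clamp (2 * z.1)) =
      (fun z => clamp (2 * z.1 + 0)) by apply/funext => z; rewrite addr0.
    exact: ct.
  apply: continuous_addr; last first.
    apply: continuous_oppr.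
    exact: (continuous_comp2 cr (@continuous_coord _ _ w)).
  pose h (z : R * {ptws W -> R}) := H z.1 z.2.
  apply: (continuous_comp2 (f := fun z : R * {ptws W -> R} =>
    h (clamp (2 * z.1 - 1), r z.2)) _ (@continuous_coord _ _ w)).
  by apply: continuous_comp2 cH; exact: continuous_pair.
- move=> t x t01 Kx; have [t2|/ltW t2] := leP t 2^-1.
    by rewrite L1 //; apply: push => //; exact: clamp_itv.
  by rewrite L2 //; apply: K'K; apply: AH; [exact: clamp_itv|exact: rK'].
- move=> x Kx; rewrite L1 ?invr_ge0 //; apply/funext => w.
  by rewrite mulr0 clamp_le0 // mul0r addr0.
- exists p; first exact: K'K.
  move=> x Kx; rewrite L2 ?invf_le1 ?ler1n // clamp_ge1; first by rewrite H1 //; exact: rK'.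
  by rewrite mulr1 lerBrDl.
Qed.

Lemma collapses_contractible (R : realType) (W : finType)
    (D : simplicial_complex W) :
  collapses [set F : {set W} | `[< faces D F >]] -> contractible R D.
Proof.
set K := [set F | _]%SET => cK.
have inK F : (F \in K) = `[< faces D F >] by rewrite inE.
(* A complex without any face is contractible by convention. *)
have [K0|K0] := pselect (K = finset.set0).
  by left; apply/seteqP; split=> // F /asboolP; rewrite -inK K0 inE.
right; have [|H cH] := collapses_contraction R _ cK K0.
  move=> F F' sF; rewrite !inK => /asboolP DF; apply/asboolP.
  exact: faces_closed DF.
apply: (contraction_contractible (H := H)).
suff -> : realization R D = realize K by [].
apply/seteqP; split=> x [x0 x1 xD]; split=> //.
  by rewrite inK; apply/asboolP.
by move: xD; rewrite inK => /asboolP.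
Qed.

(** * Apexes along chains and superlevel sets *)

Lemma apex_chain_face (W I : finType) (D : simplicial_complex W) (l : W -> I)
    (a : {set I} -> W) (C : {set {set I}}) (F : {set W}) :
  (forall S, S \in C -> l (a S) \in S /\
    forall F', faces D F' -> (forall w, w \in F' -> l w \in S) ->
      faces D (a S |: F')) ->
  (forall S S', S \in C -> S' \in C -> S \subset S' \/ S' \subset S) ->
  (forall S w, S \in C -> w \in F -> l w \in S) ->
  faces D F -> faces D (F :|: [set a S | S in C])%SET.
Proof.
have [n] := ubnP #|C|; elim: n C => // n IHn C ltCn aC chain FC DF.
have [->|[S0 CS0]] := set_0Vmem C; first by rewrite imset0 finset.setU0.
(* The apex of the largest set is added last: all labels present then lie in that set, so its cone
   property applies. *)
pose S := [arg max_(S > S0 in C) #|S|]%N.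
have [CS maxS] : S \in C /\ forall S', S' \in C -> (#|S'| <= #|S|)%N.
  by rewrite /S; case: arg_maxnP.
have [laS aS] := aC S CS.
have sub S' : S' \in C -> S' \subset S.
  move=> CS'; have [//|sS] := chain S' S CS' CS.
  by have /eqP -> : S == S' by rewrite eqEcard sS maxS.
have -> : (F :|: [set a S | S in C] = a S |: (F :|: [set a S | S in C :\ S]))%SET.
  by rewrite -{1}(finset.setD1K CS) imsetU1 finset.setUCA.
apply: aS.
  apply: IHn => //.
  - by rewrite [#|C|](cardsD1 S) CS add1n ltnS in ltCn.
  - by move=> S' /finset.setD1P[_ /aC].
  - by move=> S' S'' /finset.setD1P[_ ?] /finset.setD1P[_ ?]; exact: chain.
  - by move=> S' w /finset.setD1P[_ /FC]; apply.
move=> w; rewrite !inE => /orP[/(FC S)|]; first exact.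
case/imsetP => S' /finset.setD1P[_ CS'] ->; have [lS' _] := aC S' CS'.
exact: fintype.subsetP (sub S' CS') _ lS'.
Qed.

(* Nonzero exactly when S is a strict superlevel set of u at a nonnegative level
   (and equal to 1, as an empty product, when S is empty). *)
Definition superlevel_weight (R : realType) (I : finType) (u : I -> R)
    (S : {set I}) : R :=
  \prod_(i in S) (Num.max 0 (u i) * \prod_(j in ~: S) Num.max 0 (u i - u j)).

Lemma superlevel_weight_ge0 (R : realType) (I : finType) (u : I -> R) S :
  0 <= superlevel_weight u S.
Proof.
apply: prodr_ge0 => i _; apply: mulr_ge0; first by rewrite le_max lexx.
by apply: prodr_ge0 => j _; rewrite le_max lexx.
Qed.

Lemma max0_neq0 (R : realType) (x : R) : (Num.max 0 x != 0) = (0 < x).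
Proof. by case: ltP => [/gt_eqF ->//|_]; rewrite eqxx. Qed.

Lemma superlevel_weightP (R : realType) (I : finType) (u : I -> R) (S : {set I}) :
  reflect (forall i, i \in S -> 0 < u i /\ forall j, j \notin S -> u j < u i)
    (superlevel_weight u S != 0).
Proof.
apply: (iffP (prodf_neq0 _ _)) => uS i /uS.
  rewrite mulf_eq0 negb_or max0_neq0 => /andP[-> /prodf_neq0 uS']; split=> // j jS.
  by have := uS' j; rewrite inE jS max0_neq0 subr_gt0; apply.
case=> ui uS'; rewrite mulf_eq0 negb_or max0_neq0 ui; apply/prodf_neq0 => j.
by rewrite inE max0_neq0 subr_gt0; exact: uS'.
Qed.

Lemma superlevel_weight_chain (R : realType) (I : finType) (u : I -> R)
    (S S' : {set I}) :
  superlevel_weight u S != 0 -> superlevel_weight u S' != 0 ->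
  S \subset S' \/ S' \subset S.
Proof.
move=> /superlevel_weightP uS /superlevel_weightP uS'.
have [|/subsetPn[i iS iS']] := boolP (S \subset S'); [by left|right].
apply/fintype.subsetP => j jS'; apply: contraT => jS.
have [_ /(_ _ jS) ji] := uS i iS; have [_ /(_ _ iS') ij] := uS' j jS'.
by have := lt_trans ij ji; rewrite ltxx.
Qed.

(** The set of maximizers is a strict superlevel set. This makes the total weight positive, as
    normalization requires. *)
Lemma superlevel_weight_argmax (R : realType) (I : finType) (u : I -> R) i0 :
  0 < u i0 -> exists2 S, S != finset.set0 & superlevel_weight u S != 0.
Proof.
move=> u0; pose i := [arg max_(i > i0) u i]%O.
have [maxi ui] : (forall j, u j <= u i) /\ 0 < u i.
  rewrite /i; case: arg_maxP => //= k _ maxk; split=> [j|]; first exact: maxk.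
  by apply: lt_le_trans u0 _; exact: maxk.
exists [set j | u j == u i]%SET; first by apply/set0Pn; exists i; rewrite inE.
apply/superlevel_weightP => j; rewrite inE => /eqP uj; rewrite uj.
by split=> // k; rewrite inE => uk; rewrite lt_neqAle uk maxi.
Qed.

Lemma superlevel_weight0 (R : realType) (I : finType) (S : {set I}) :
  S != finset.set0 -> superlevel_weight (fun=> 0 : R) S = 0.
Proof.
case/set0Pn => i iS; apply/eqP; apply: contraT => /superlevel_weightP /(_ i iS)[].
by rewrite ltxx.
Qed.

(** The homotopy inverse before normalization: the superlevel weights act as unnormalized
    barycentric coordinates on the subdivision, and the barycenter of [S] is sent to [a S]. *)
Definition apex_sum (R : realType) (W I : finType) (a : {set I} -> W)
    (u : I -> R) : {ptws W -> R} := fun w =>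
  \sum_(S : {set I} | (S != finset.set0) && (a S == w)) superlevel_weight u S.

Definition normalize (R : realType) (W : finType) (h : {ptws W -> R}) :
  {ptws W -> R} := fun w => h w / \sum_v h v.

(** The linear extension of the vertex map [l] to barycentric coordinates. *)
Definition label_sum (R : realType) (W I : finType) (l : W -> I)
    (y : {ptws W -> R}) (i : I) : R := \sum_(w | l w == i) y w.

Lemma apex_sum_ge0 (R : realType) (W I : finType) (a : {set I} -> W)
    (u : I -> R) w : 0 <= apex_sum a u w.
Proof. by apply: sumr_ge0 => S _; exact: superlevel_weight_ge0. Qed.

Lemma apex_sum_neq0 (R : realType) (W I : finType) (a : {set I} -> W)
    (u : I -> R) w : apex_sum a u w != 0 ->
  exists S, [/\ S != finset.set0, a S = w & superlevel_weight u S != 0].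
Proof.
rewrite psumr_neq0 => [/hasP[S _ /andP[/andP[S0 /eqP aS] uS]]|S _].
  by exists S; split=> //; rewrite gt_eqF.
exact: superlevel_weight_ge0.
Qed.

Lemma apex_sum_total_gt0 (R : realType) (W I : finType) (a : {set I} -> W)
    (u : I -> R) i0 : 0 < u i0 -> 0 < \sum_w apex_sum a u w.
Proof.
move=> /superlevel_weight_argmax[S S0 uS].
rewrite (bigD1 (a S)) //= ltr_pwDl //; last first.
  by apply: sumr_ge0 => w _; exact: apex_sum_ge0.
rewrite /apex_sum (bigD1 S) ?S0 ?eqxx //= ltr_pwDl //.
  by rewrite lt_def uS superlevel_weight_ge0.
by apply: sumr_ge0 => S' _; exact: superlevel_weight_ge0.
Qed.

Lemma apex_sum0 (R : realType) (W I : finType) (a : {set I} -> W) w :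
  apex_sum a (fun=> 0 : R) w = 0.
Proof. by apply: big1 => S /andP[S0 _]; exact: superlevel_weight0. Qed.

Lemma normalize_realization (R : realType) (W : finType)
    (D : simplicial_complex W) (h : {ptws W -> R}) (F : {set W}) :
  (forall w, 0 <= h w) -> 0 < \sum_w h w -> (forall w, h w != 0 -> w \in F) ->
  faces D F -> realization R D (normalize h).
Proof.
move=> h0 hpos hF DF; split.
- by move=> w; rewrite divr_ge0 // ltW.
- by rewrite -mulr_suml divff // gt_eqF.
- apply: faces_closed DF; apply/fintype.subsetP => w; rewrite inE mulf_eq0 negb_or.
  by case/andP => /hF.
Qed.

Lemma label_sum_ge0 (R : realType) (W I : finType) (l : W -> I)
    (y : {ptws W -> R}) i : (forall w, 0 <= y w) -> 0 <= label_sum l y i.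
Proof. by move=> y0; exact: sumr_ge0. Qed.

Lemma sum_label_sum (R : realType) (W I : finType) (l : W -> I)
    (y : {ptws W -> R}) : \sum_i label_sum l y i = \sum_w y w.
Proof. by rewrite [RHS](partition_big l xpredT). Qed.

Lemma le_label_sum (R : realType) (W I : finType) (l : W -> I)
    (y : {ptws W -> R}) w : (forall w, 0 <= y w) -> y w <= label_sum l y (l w).
Proof.
by move=> y0; rewrite /label_sum (bigD1 w) //= lerDl; exact: sumr_ge0.
Qed.

(** * Spheres from cone apexes *)

(** The faces with labels in [S] form a cone with apex [a S]. Its label lies in [S], so that apexes
    of larger sets can still be added afterwards. *)
Definition apex_choice (W I : finType) (D : simplicial_complex W) (l : W -> I)
    (a : {set I} -> W) : Prop :=
  forall S : {set I}, S != finset.set0 -> S != finset.setT -> l (a S) \in S /\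
    forall F, faces D F -> (forall w, w \in F -> l w \in S) -> faces D (a S |: F).

(** The nonempty sets of nonzero weight form a chain and avoid [i0]; hence they are proper, and
    their apexes can be added to [F]. *)
Lemma superlevel_face (R : realType) (W I : finType) (D : simplicial_complex W)
    (l : W -> I) (a : {set I} -> W) (F : {set W}) (u : I -> R) (i0 : I) :
  apex_choice D l a -> u i0 <= 0 ->
  (forall (S : {set I}) w, S != finset.set0 -> superlevel_weight u S != 0 ->
    w \in F -> l w \in S) ->
  faces D F ->
  exists2 F', faces D F' & F \subset F' /\ forall w, apex_sum a u w != 0 -> w \in F'.
Proof.
move=> aD ui0 FS DF.
pose C := [set S : {set I} | (S != finset.set0) && (superlevel_weight u S != 0)]%SET.
exists (F :|: [set a S | S in C])%SET; last first.
  split; first exact: finset.subsetUl.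
  move=> w /apex_sum_neq0[S [S0 aS uS]]; rewrite inE; apply/orP; right.
  by apply/imsetP; exists S; rewrite // inE S0 uS.
apply: (apex_chain_face (l := l)) => //.
- move=> S; rewrite inE => /andP[S0 uS]; apply: aD => //.
  apply: contraTneq uS => ->; apply/negP => /superlevel_weightP /(_ i0).
  by rewrite inE ltNge ui0 => -[].
- move=> S S'; rewrite !inE => /andP[_ uS] /andP[_ uS'].
  exact: superlevel_weight_chain uS uS'.
- by move=> S w; rewrite inE => /andP[S0 uS]; exact: FS.
Qed.

Lemma continuous_superlevel_weight (R : realType) (T : topologicalType)
    (I : finType) (u : T -> I -> R) (S : {set I}) :
  (forall i, continuous (u ^~ i)) -> continuous (fun x => superlevel_weight (u x) S).
Proof.
move=> cu; apply: continuous_prodr => i _; apply: continuous_mulr.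
  by apply: continuous_maxr => //; exact: continuous_cstr.
apply: continuous_prodr => j _; apply: continuous_maxr; first exact: continuous_cstr.
by apply: continuous_addr => //; exact: continuous_oppr.
Qed.

Lemma continuous_apex_sum (R : realType) (T : topologicalType) (W I : finType)
    (a : {set I} -> W) (u : T -> I -> R) w :
  (forall i, continuous (u ^~ i)) -> continuous (fun x => apex_sum a (u x) w).
Proof.
by move=> cu; apply: continuous_sumr => S _; exact: continuous_superlevel_weight.
Qed.

Lemma continuous_normalize (R : realType) (T : topologicalType) (W : finType)
    (h : T -> {ptws W -> R}) :
  (forall w, continuous (fun x => h x w)) -> (forall x, 0 < \sum_w h x w) ->
  continuous (fun x => normalize (h x)).
Proof.
move=> ch hpos; apply: continuous_ptws => w; apply: continuous_mulr => //.
apply: continuous_invr => [x|]; first by rewrite gt_eqF.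
exact: continuous_sumr.
Qed.

(** * The sphere as a quotient by the diagonal *)

Definition diag_dist (R : realType) (n : nat) (z : 'I_n.+2 -> R) : R :=
  Num.sqrt (\sum_(i < n.+1) (z (lift ord0 i) - z ord0) ^+ 2).

(* Quotient of R^(n+2) by the diagonal, identified with R^(n+1), followed by the
   radial projection. *)
Definition to_sphere (R : realType) (n : nat) (z : 'I_n.+2 -> R) : 'rV[R]_n.+1 :=
  \row_i ((z (lift ord0 i) - z ord0) / diag_dist z).

Definition row_ext (R : realType) (n : nat) (p : 'rV[R]_n.+1) (k : 'I_n.+2) : R :=
  oapp (p ord0) 0 (unlift ord0 k).

(** The representative modulo the diagonal whose smallest coordinate is 0. The default 0 of the
    minimum is harmless because [row_ext p] is 0 at [ord0]. *)
Definition of_sphere (R : realType) (n : nat) (p : 'rV[R]_n.+1) (k : 'I_n.+2) : R :=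
  row_ext p k - \big[Num.min/0]_j row_ext p j.

(** [diag_dist] vanishes only on the diagonal, and a diagonal point with a zero coordinate is 0. *)
Lemma diag_dist_gt0 (R : realType) (n : nat) (z : 'I_n.+2 -> R) i0 :
  (forall i, 0 <= z i) -> z i0 = 0 -> 0 < \sum_i z i -> 0 < diag_dist z.
Proof.
move=> z0 zi0 zpos; rewrite sqrtr_gt0 lt_def sumr_ge0 ?andbT => [|i _]; last first.
  exact: sqr_ge0.
apply/negP => /eqP /psumr_eq0P z2.
have zc i : z i = z ord0.
  have [j ->|->//] := unliftP ord0 i.
  apply/eqP; rewrite -subr_eq0 -sqrf_eq0; apply/eqP; apply: z2 => // j' _.
  exact: sqr_ge0.
move: zpos; rewrite big1 ?ltxx // => i _.
by rewrite zc -zi0 zc.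
Qed.

Lemma to_sphere_in (R : realType) (n : nat) (z : 'I_n.+2 -> R) :
  0 < diag_dist z -> sphere R n (to_sphere z).
Proof.
move=> zpos; rewrite /sphere /=.
under eq_bigr do rewrite mxE expr_div_n.
rewrite -mulr_suml -[X in X / _]sqr_sqrtr; last by apply: sumr_ge0 => i _; exact: sqr_ge0.
by rewrite -/(diag_dist z) divff // expf_neq0 // gt_eqF.
Qed.

Lemma row_ext_lift (R : realType) (n : nat) (p : 'rV[R]_n.+1) i :
  row_ext p (lift ord0 i) = p ord0 i.
Proof. by rewrite /row_ext liftK. Qed.

Lemma row_ext0 (R : realType) (n : nat) (p : 'rV[R]_n.+1) : row_ext p ord0 = 0.
Proof. by rewrite /row_ext unlift_none. Qed.

Lemma of_sphereK (R : realType) (n : nat) (p : 'rV[R]_n.+1) :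
  sphere R n p -> to_sphere (of_sphere p) = p.
Proof.
move=> p1; have E i : of_sphere p (lift ord0 i) - of_sphere p ord0 = p ord0 i.
  by rewrite /of_sphere row_ext_lift row_ext0 sub0r opprK subrK.
have e1 : diag_dist (of_sphere p) = 1.
  by rewrite /diag_dist; under eq_bigr do rewrite E; rewrite p1 sqrtr1.
by apply/rowP => i; rewrite mxE e1 divr1 E.
Qed.

Lemma of_sphere_ge0 (R : realType) (n : nat) (p : 'rV[R]_n.+1) k :
  0 <= of_sphere p k.
Proof. by rewrite subr_ge0; exact: bigmin_le_cond. Qed.

Lemma of_sphere_eq0 (R : realType) (n : nat) (p : 'rV[R]_n.+1) :
  exists k, of_sphere p k = 0.
Proof.
suff [k e] : exists k, \big[Num.min/0]_j row_ext p j = row_ext p k.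
  by exists k; rewrite /of_sphere e subrr.
elim/big_ind: _ => [|x y IHx IHy|k _]; last by exists k.
  by exists ord0; rewrite row_ext0.
by rewrite minEle; case: ifP.
Qed.

Lemma of_sphere_gt0 (R : realType) (n : nat) (p : 'rV[R]_n.+1) :
  sphere R n p -> exists k, 0 < of_sphere p k.
Proof.
move=> p1; apply: contrapT => nex.
have z k : of_sphere p k = 0.
  apply/eqP; rewrite eq_le of_sphere_ge0 andbT leNgt; apply/negP => ?; apply: nex.
  by exists k.
have := p1; rewrite /sphere /= -(of_sphereK p1) big1 => [/esym/eqP|i _].
  by rewrite oner_eq0.
by rewrite mxE !z subrr mul0r expr0n.
Qed.

(** [z] is already the representative with minimum 0, so it comes back up to the scaling of the
    radial projection. *)
Lemma to_sphereK (R : realType) (n : nat) (z : 'I_n.+2 -> R) i0 :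
  (forall i, 0 <= z i) -> z i0 = 0 -> of_sphere (to_sphere z) = fun i => z i / diag_dist z.
Proof.
move=> z0 zi0; have dist0 : 0 <= diag_dist z by exact: sqrtr_ge0.
have E k : row_ext (to_sphere z) k = (z k - z ord0) / diag_dist z.
  have [i ->|->] := unliftP ord0 k; first by rewrite row_ext_lift mxE.
  by rewrite row_ext0 subrr mul0r.
suff -> : of_sphere (to_sphere z) =
    fun k => row_ext (to_sphere z) k + z ord0 / diag_dist z.
  by apply/funext => k; rewrite E -mulrDl subrK.
apply/funext => k; congr (_ + _); apply/eqP; rewrite eqr_oppLR; apply/eqP/le_anti.
apply/andP; split.
  rewrite -mulNr -[- z ord0]sub0r -zi0 -E.
  exact: bigmin_le_cond.
apply/bigmin_geP; split; first by rewrite oppr_le0 divr_ge0.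
by move=> i _; rewrite E -mulNr ler_wpM2r ?invr_ge0 // -[leLHS]add0r lerD2r.
Qed.

Lemma continuous_diag_dist (R : realType) (T : topologicalType) (n : nat)
    (z : T -> 'I_n.+2 -> R) :
  (forall i, continuous (z ^~ i)) -> continuous (fun x => diag_dist (z x)).
Proof.
move=> cz; apply: continuous_comp2 (@sqrt_continuous R).
apply: continuous_sumr => i _; apply: continuous_mulr.
  by apply: continuous_addr => //; exact: continuous_oppr.
by apply: continuous_addr => //; exact: continuous_oppr.
Qed.

Lemma continuous_to_sphere (R : realType) (T : topologicalType) (n : nat)
    (z : T -> 'I_n.+2 -> R) :
  (forall i, continuous (z ^~ i)) -> (forall x, 0 < diag_dist (z x)) ->
  continuous (fun x => to_sphere (z x)).
Proof.
move=> cz zpos; apply: continuous_row => i.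
have -> : (fun x => to_sphere (z x) ord0 i) =
    (fun x => (z x (lift ord0 i) - z x ord0) / diag_dist (z x)).
  by apply/funext => x; rewrite mxE.
apply: continuous_mulr; first by apply: continuous_addr => //; exact: continuous_oppr.
apply: continuous_invr => [x|]; first by rewrite gt_eqF.
exact: continuous_diag_dist.
Qed.

Lemma continuous_of_sphere (R : realType) (n : nat) k :
  continuous (fun p : 'rV[R]_n.+1 => of_sphere p k).
Proof.
have cext j : continuous (fun p : 'rV[R]_n.+1 => row_ext p j).
  have [i ->|->] := unliftP ord0 j.
    under eq_fun do rewrite row_ext_lift.
    exact: coord_continuous.
  under eq_fun do rewrite row_ext0.
  exact: continuous_cstr.
apply: continuous_addr => //; apply: continuous_oppr.
apply: continuous_big => //.
by apply: continuous_minr; [exact: continuous_fst|exact: continuous_snd].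
Qed.

(** * The homotopy equivalence with the sphere *)

Theorem apex_choice_sphere (R : realType) (W : finType) (n : nat)
    (D : simplicial_complex W) (l : W -> 'I_n.+2) (a : {set 'I_n.+2} -> W) :
  faces D finset.set0 ->
  (forall F, faces D F -> exists i, forall w, w \in F -> l w != i) ->
  apex_choice D l a ->
  homotopy_equivalent R (set_type (realization R D)) (set_type (sphere R n)).
Proof.
move=> D0 miss aD.
pose z (y : {ptws W -> R}) := label_sum l y.
have missz y : realization R D y -> exists i, z y i = 0.
  case=> _ _ /miss[i yi]; exists i; apply: big1 => w /eqP lw.
  by apply/eqP; apply: contraT => yw; have := yi w; rewrite inE lw eqxx yw => /(_ isT).
have z0 y i : realization R D y -> 0 <= z y i.
  by case=> y0 _ _; exact: label_sum_ge0.
have z1 y : realization R D y -> \sum_i z y i = 1.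
  by case=> _ y1 _; rewrite sum_label_sum.
have zpos y : realization R D y -> 0 < diag_dist (z y).
  move=> Dy; have [i zi] := missz y Dy.
  by apply: (diag_dist_gt0 _ zi) => [j|]; [exact: z0|rewrite z1].
have gpos p : sphere R n p -> 0 < \sum_w apex_sum a (of_sphere p) w.
  by move=> /of_sphere_gt0[k]; exact: apex_sum_total_gt0.
have Dg p : sphere R n p -> realization R D (normalize (apex_sum a (of_sphere p))).
  move=> p1; have [k pk] := of_sphere_eq0 p.
  have [||//|F DF [_ FS]] := superlevel_face (u := of_sphere p) (F := finset.set0) (i0 := k) aD.
  - by rewrite pk.
  - by move=> S w _ _; rewrite inE.
  apply: normalize_realization FS DF; [exact: apex_sum_ge0|exact: gpos].
(* [f] maps to the boundary of the simplex on the labels and projects radially; [g] distributes the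
   superlevel weights of the representative over the apexes. *)
pose f (y : set_type (realization R D)) : set_type (sphere R n) :=
  to_set (to_sphere_in (zpos (\val y) (set_valP y))).
pose g (p : set_type (sphere R n)) : set_type (realization R D) :=
  to_set (Dg (\val p) (set_valP p)).
have cval (T : topologicalType) (y : T -> set_type (realization R D)) w :
    continuous y -> continuous (fun x => \val (y x) w).
  move=> cy; apply: (continuous_comp2 (f := fun x => \val (y x)) _ (@continuous_coord _ _ w)).
  exact: continuous_comp2 cy (@continuous_set_val _ _).
have cz (T : topologicalType) (y : T -> set_type (realization R D)) i :
    continuous y -> continuous (fun x => z (\val (y x)) i).
  by move=> cy; apply: continuous_sumr => w _; exact: cval.
have cof (T : topologicalType) (p : T -> set_type (sphere R n)) k :
    continuous p -> continuous (fun x => of_sphere (\val (p x)) k).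
  move=> cp; apply: (continuous_comp2 (f := fun x => \val (p x)) _ (@continuous_of_sphere _ _ k)).
  exact: continuous_comp2 cp (@continuous_set_val _ _).
have cid (T : topologicalType) : continuous (fun x : T => x) by move=> x; exact: cvg_id.
have cf : continuous f.
  apply: continuous_set_type.
  apply: (continuous_to_sphere
    (z := fun y : set_type (realization R D) => z (\val y))).
    by move=> i; exact: cz.
  by move=> y; exact: (zpos _ (set_valP y)).
have cg : continuous g.
  apply: continuous_set_type.
  apply: (continuous_normalize
    (h := fun p : set_type (sphere R n) => apex_sum a (of_sphere (\val p)))).
    by move=> w; apply: continuous_apex_sum => i; exact: cof.
  by move=> p; exact: (gpos _ (set_valP p)).
exists f, g; split=> //.
- (* The parts of y whose labels exceed the level 1 - t are kept; below that level
     the label sums are spread over the apexes of their superlevel sets, all of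
     which contain the labels kept. *)
  pose h (t : R) (y : {ptws W -> R}) : {ptws W -> R} := fun w =>
    Num.min (y w) (Num.max 0 (z y (l w) - (1 - t))) +
    apex_sum a (fun i => Num.min (z y i) (1 - t) / diag_dist (z y)) w.
  have h0 t y w : realization R D y -> 0 <= h t y w.
    case=> y0 _ _; rewrite addr_ge0 ?apex_sum_ge0 //.
    by rewrite le_min y0 le_max lexx.
  have h1 y : realization R D y -> h 1 y = y.
    move=> Dy; have [y0 _ _] := Dy.
    apply/funext => w; rewrite /h subrr subr0.
    rewrite (max_idPr _) ?z0 // (min_idPl _) ?le_label_sum //.
    have -> : (fun i => Num.min (z y i) 0 / diag_dist (z y)) = fun=> 0.
      by apply/funext => i; rewrite (min_idPr _) ?mul0r // z0.
    by rewrite apex_sum0 addr0.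
  have hpos t y : 0 <= t <= 1 -> realization R D y -> 0 < \sum_w h t y w.
    move=> /andP[t0 t1] Dy; have [->|tn1] := eqVneq t 1.
      by rewrite h1 //; have [_ -> _] := Dy.
    (* Before time 1 the level is positive, and so is the truncated sum of some label. *)
    have t1' : 0 < 1 - t by rewrite subr_gt0 lt_neqAle tn1.
    have [i zi] : exists i, 0 < z y i.
      have : \sum_i z y i != 0 by rewrite z1 ?oner_neq0.
      rewrite psumr_neq0 => [/hasP[i _ /andP[_ zi]]|i _]; last exact: z0.
      by exists i.
    rewrite big_split /= ltr_wpDl //.
      by apply: sumr_ge0 => w _; have [y0 _ _] := Dy; rewrite le_min y0 le_max lexx.
    apply: (apex_sum_total_gt0 _ (i0 := i)).
    by rewrite divr_gt0 ?zpos // lt_min zi t1'.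
  apply: (@homotopic_clamp R _ _ _ _ _
    (fun t (y : set_type (realization R D)) => normalize (h t (\val y)))).
  + pose y (x : R * set_type (realization R D)) := x.2.
    have cy : continuous y by exact: continuous_snd.
    have ct : continuous (fun x : R * set_type (realization R D) => 1 - clamp x.1).
      apply: continuous_addr; first exact: continuous_cstr.
      by apply: continuous_oppr; apply: continuous_clamp; exact: continuous_fst.
    apply: (continuous_normalize (h := fun x : R * set_type (realization R D) =>
      h (clamp x.1) (\val (y x)))) => [w|x].
      apply: continuous_addr; [apply: continuous_minr; first exact: cval|].
        apply: continuous_maxr; first exact: continuous_cstr.
        by apply: continuous_addr; [exact: cz|exact: continuous_oppr].
      apply: continuous_apex_sum => i; apply: continuous_mulr.
        by apply: continuous_minr => //; exact: cz.
      apply: continuous_invr => [x|]; first by rewrite gt_eqF // zpos //; exact: set_valP.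
      by apply: continuous_diag_dist => j; exact: cz.
    by apply: hpos; [exact: clamp_itv|exact: set_valP].
  + move=> t [y yD] t01; have /= Dy := set_mem yD; have /andP[t0 t1] := t01.
    pose u i := Num.min (z y i) (1 - t) / diag_dist (z y).
    have [k zk] := missz y Dy.
    pose F := [set w | (y w != 0) && (1 - t < z y (l w))]%SET.
    have DF : faces D F.
      have [_ _] := Dy; apply: faces_closed; apply/fintype.subsetP => w.
      by rewrite !inE => /andP[].
    have [||F' DF' [FF' uF']] := superlevel_face (u := u) (i0 := k) aD _ _ DF.
    * by rewrite /u zk (min_idPl _) ?mul0r // subr_ge0.
    (* A label of [F] attains the level [1 - t] at which all values are cut, so no label exceeds it
       strictly and it lies in every nonempty superlevel set. *)
    * move=> S w /set0Pn[i iS] /superlevel_weightP /(_ i iS)[_ ltu].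
      rewrite inE => /andP[_ zw]; apply: contraT => /ltu.
      rewrite /u ltr_pM2r ?invr_gt0 ?zpos // (min_idPr (ltW zw)).
      by rewrite lt_min ltxx andbF.
    apply: (normalize_realization (F := F')) => //.
    * by move=> w; exact: h0.
    * exact: hpos.
    move=> w hw; have [yw|nw] := boolP (w \in F); first exact: (fintype.subsetP FF').
    apply: uF'; apply: contraNneq nw => uw; move: hw; rewrite /h uw addr0 inE.
    case: (eqVneq (y w) 0) => [->|_ /=].
      by rewrite (min_idPl _) ?eqxx // le_max lexx.
    apply: contraR; rewrite -leNgt => zw.
    by rewrite (max_idPl _) ?subr_le0 // (min_idPr _) //; have [] := Dy.
  (* At time 0 the level is 1, which no label sum exceeds: the first summand is 0 and nothing is
     cut. *)
  + move=> y; have Dy := set_valP y; have [y0 _ _] := Dy.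
    have [k zk] := missz _ Dy; rewrite /= (to_sphereK _ zk) => [|i]; last exact: z0.
    congr normalize; apply/funext => w; rewrite /h subr0.
    have zle1 i : z (\val y) i <= 1.
      by rewrite -(z1 _ Dy) (bigD1 i) //= lerDl sumr_ge0 // => j _; exact: z0.
    rewrite (max_idPl _) ?subr_le0 // (min_idPr (y0 w)) add0r.
    by congr (apex_sum a _ w); apply/funext => i; rewrite (min_idPl _).
  + move=> y; have Dy := set_valP y; rewrite h1 //; have [_ y1 _] := Dy.
    by apply/funext => w; rewrite /normalize y1 divr1.
- (* Both endpoints are nonnegative and vanish at a common coordinate, so the
     segment between them avoids the diagonal. *)
  pose q (t : R) (p : set_type (sphere R n)) (i : 'I_n.+2) : R :=
    (1 - t) * z (\val (g p)) i + t * of_sphere (\val p) i.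
  have qpos t p : 0 <= t <= 1 -> 0 < diag_dist (q t p).
    move=> /andP[t0 t1]; have Dgp := set_valP (g p).
    have t1' : 0 <= 1 - t by rewrite subr_ge0.
    have [k pk] := of_sphere_eq0 (\val p).
    apply: (diag_dist_gt0 (i0 := k)).
    * by move=> i; rewrite addr_ge0 // mulr_ge0 ?z0 ?of_sphere_ge0.
    * rewrite /q pk mulr0 addr0; apply/eqP; rewrite mulf_eq0; apply/orP; right.
      apply/eqP/big1 => w /eqP lw; rewrite /= /normalize.
      (* Superlevel sets avoid the zero coordinate [k] and contain the labels of their apexes, so
         [g p] puts no weight on the label [k]. *)
      suff -> : apex_sum a (of_sphere (\val p)) w = 0 by rewrite mul0r.
      apply/eqP; apply: contraT => /apex_sum_neq0[S [S0 aS uS]].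
      have kS : k \notin S.
        by apply/negP => kS; have [] := superlevel_weightP _ _ uS k kS; rewrite pk ltxx.
      have [|laS _] := aD S S0; first by apply: contraNneq kS => ->; rewrite inE.
      by rewrite -lw -aS laS in kS.
    * rewrite big_split /= -!mulr_sumr z1 // mulr1.
      have [i pi] := of_sphere_gt0 (set_valP p).
      have spos : 0 < \sum_i of_sphere (\val p) i.
        by rewrite (bigD1 i) //= ltr_pwDl // sumr_ge0 // => j _; exact: of_sphere_ge0.
      have [->|tn0] := eqVneq t 0; first by rewrite mul0r addr0 subr0.
      by rewrite ltr_wpDl // mulr_gt0 // lt_def tn0.
  apply: (@homotopic_clamp R _ _ _ _ _ (fun t (p : set_type (sphere R n)) => to_sphere (q t p))).
  + apply: (continuous_to_sphere (z := fun x : R * set_type (sphere R n) =>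
      q (clamp x.1) x.2)) => [i|x]; last first.
      by apply: qpos; exact: clamp_itv.
    have ct : continuous (fun x : R * set_type (sphere R n) => clamp x.1).
      by apply: continuous_clamp; exact: continuous_fst.
    apply: continuous_addr; apply: continuous_mulr => //.
    * by apply: continuous_addr; [exact: continuous_cstr|exact: continuous_oppr].
    * apply: (cz _ (fun x : R * set_type (sphere R n) => g x.2)).
      exact: continuous_comp2 (@continuous_snd _ _) cg.
    * apply: (cof _ (fun x : R * set_type (sphere R n) => x.2)); exact: continuous_snd.
  + by move=> t p t01; apply: to_sphere_in; exact: qpos.
  + move=> p /=; congr to_sphere; apply/funext => i.
    by rewrite /q subr0 mul1r mul0r addr0.
  + move=> p; rewrite /= -[RHS]of_sphereK; last exact: set_valP.
    by congr to_sphere; apply/funext => i; rewrite /q subrr mul0r mul1r add0r.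
Qed.

(** * Nonsinks as labels of the arcs *)

Lemma nonsinksP (G : digraph) (v : vert G) :
  reflect (exists e, src e = v) (v \in nonsinks G).
Proof.
by apply: (iffP (imfsetP _ _ _ _)) => [[e _ ->]|[e <-]]; [exists e|exists e].
Qed.

Lemma path_free_sphere (R : realType) (G : digraph) (n : nat) :
  (forall e : darc G, ~ useless e) -> ~ has_cycle G -> (0 < #|darc G|)%N ->
  #|` nonsinks G| = n.+2 ->
  homotopy_equivalent R (set_type (realization R (path_free G)))
    (set_type (sphere R n)).
Proof.
move=> useful acyc arcs cardN; have /card_gt0P[e0 _] := arcs.
(* A sink gets the default label [ord0]; this is harmless, as [path_free_apex] accepts any predicate
   on vertices. *)
pose lv (v : vert G) : 'I_n.+2 := inord (index v (nonsinks G)).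
have lvE v : v \in nonsinks G -> lv v = index v (nonsinks G) :> nat.
  by move=> vN; rewrite inordK // -cardN index_mem.
have lv_inj u v : u \in nonsinks G -> v \in nonsinks G -> lv u = lv v -> u = v.
  move=> uN vN /(congr1 val); rewrite /= !lvE // => uv.
  by rewrite -(nth_index u uN) uv nth_index.
have lv_surj i : exists e : darc G, lv (src e) = i.
  have iN : (i < size (nonsinks G))%N by rewrite -/(#|` nonsinks G|) cardN.
  have /nonsinksP[e ei] := mem_nth (src e0) iN.
  exists e; apply: ord_inj; rewrite lvE; last by apply/nonsinksP; exists e.
  by rewrite ei index_uniq // fset_uniq.
have [a aP] : {a : {set 'I_n.+2} -> darc G |
    apex_choice (path_free G) (fun e => lv (src e)) a}.
  suff /choice[a aP] : forall S : {set 'I_n.+2}, exists b : darc G,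
      S != finset.set0 -> S != finset.setT -> lv (src b) \in S /\
      forall F, path_free_faces F -> (forall w, w \in F -> lv (src w) \in S) ->
        path_free_faces (b |: F) by exists a.
  (* [e0] is a dummy value for the empty and the full set. *)
  move=> S; have [->|S0] := eqVneq S finset.set0; first by exists e0.
  have [->|ST] := eqVneq S finset.setT; first by exists e0.
  have /set0Pn[i iS] := S0.
  have /subsetPn[j _ jS] : ~~ (finset.setT \subset S) by rewrite finset.subTset.
  have [e1 ei] := lv_surj i; have [e2 ej] := lv_surj j.
  have [|| b Sb bP] := @path_free_apex G (fun v => lv v \in S) e1 e2 useful.
  - by rewrite ei.
  - by rewrite ej.
  by exists b.
apply: (apex_choice_sphere R _ _ aP).
(* The empty set is a face because the existence of a useful arc forces [s_ G] and [t_ G] to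
   differ. *)
- apply/path_freeP => -[_ [[|e p] [<- /= pw pF]]].
    by have [] := useful_arc_endpoints (useful e0).
  by have := pF e (mem_head _ _); rewrite inE.
- move=> F /(path_free_missing useful acyc arcs)[e eF].
  exists (lv (src e)) => f /eF; apply: contra_notN => /eqP.
  by apply: lv_inj; apply/nonsinksP; [exists f|exists e].
Qed.

Theorem theorem1p10 (R : realType) (G : digraph)
    (arcs_nonempty : (0 < #|darc G|)%N) :
  (((exists e : darc G, useless e) \/ has_cycle G) ->
     contractible R (path_free G)) /\
  (~ ((exists e : darc G, useless e) \/ has_cycle G) ->
     homotopy_sphere R (path_free G) ((#|` nonsinks G|)%:Z - 2)).
Proof.
split=> [/collapses_path_free c|bad].
  exact: (collapses_contractible R (D := path_free G) c).
have useful (e : darc G) : ~ useless e by move=> ue; apply: bad; left; exists e.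
have acyc : ~ has_cycle G by move=> cyc; apply: bad; right.
have /card_gt0P[e0 _] := arcs_nonempty.
have e0N : src e0 \in nonsinks G by apply/nonsinksP; exists e0.
case cardN : #|` nonsinks G| => [|[|n]].
- by move/cardfs0_eq: cardN => N0; rewrite N0 inE in e0N.
(* With a single nonsink all arcs start there; a face has no arc leaving some nonsink, so it is
   empty, and the dimension is -1. *)
- have /cardfs1P[v Nv] : #|` nonsinks G| == 1 by rewrite cardN.
  have srcv (e : darc G) : src e = v.
    by have : src e \in nonsinks G by [apply/nonsinksP; exists e]; rewrite Nv inE => /eqP.
  apply/seteqP; split=> [F /(path_free_missing useful acyc arcs_nonempty)[e eF]|_ ->] /=.
    apply/eqP; apply: contraT => /set0Pn[f /eF].
    by rewrite !srcv.
  apply/path_freeP => -[_ [[|e p] [<- /= pw pF]]].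
    by have [] := useful_arc_endpoints (useful e0).
  by have := pF e (mem_head _ _); rewrite inE.
- have -> : n.+2%:Z - 2 = n by rewrite -addn2 PoszD addrK.
  exact: path_free_sphere.
Qed.
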